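(* Let $m\ge1$ and let $\tau,\tau'\in S_{m+1}$ be permutations without self-overlaps such that $\tau(1)=\tau'(1)$ and $\tau(m+1)=\tau'(m+1)$. Then for every $n$ and every $k$, the number of permutations of length $n$ with exactly $k$ occurrences of $\tau$ equals the number of permutations of length $n$ with exactly $k$ occurrences of $\tau'$. (That is, for non-self-overlapping patterns of length $m+1$, this number depends only on $m$, $\tau(1)$ and $\tau(m+1)$.)
   Context: A permutation of length $n$ is a sequence containing each of $1,\dots,n$ exactly once; $S_n$ is the set of these. For a sequence $s$ of distinct integers, $\mathrm{st}(s)$ is the unique permutation with the same relative order of entries. An occurrence of $\tau$ in $\sigma$ (as a consecutive pattern) is a segment $\sigma_i\cdots\sigma_j$ with $\mathrm{st}(\sigma_i\cdots\sigma_j)=\tau$. A pattern $\tau\in S_{m+1}$ has no self-overlaps if every permutation of length at most $2m$ has at most one occurrence of $\tau$. *)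

(* Defs.v *)
From mathcomp Require Import all_boot all_fingroup.
Set Implicit Arguments.
Unset Strict Implicit.
Unset Printing Implicit Defensive.

(* 'S_n acts on {0, ..., n-1}; [word s] is the one-line notation on {1, ..., n}. *)
Definition word (n : nat) (s : 'S_n) : seq nat :=
  [seq (val (s i)).+1 | i <- enum 'I_n].

(* For a sequence of distinct numbers, each entry is replaced by its rank in
   {1, ..., size s}; [st_perm], [st_order] and [st_unique] below show that this
   is the unique permutation with the same relative order as s. *)
Definition st (s : seq nat) : seq nat :=
  [seq count (fun y => y <= x) s | x <- s].

(* Inclusive and 0-based on both ends; empty when j < i. *)
Definition segment (s : seq nat) (i j : nat) : seq nat :=
  take (j.+1 - i) (drop i s).

Definition occurrences (k n : nat) (tau : 'S_k) (sigma : 'S_n) :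
    {set 'I_n * 'I_n} :=
  [set p : 'I_n * 'I_n |
    (p.1 <= p.2) && (st (segment (word sigma) p.1 p.2) == word tau)].

Definition nb_occ (k n : nat) (tau : 'S_k) (sigma : 'S_n) : nat :=
  #|occurrences tau sigma|.

Definition no_self_overlap (m : nat) (tau : 'S_m.+1) : Prop :=
  forall (n : nat) (sigma : 'S_n), n <= 2 * m -> nb_occ tau sigma <= 1.

Definition nb_perm_occ (k : nat) (tau : 'S_k) (n q : nat) : nat :=
  #|[set sigma : 'S_n | nb_occ tau sigma == q]|.

Lemma size_st s : size (st s) = size s.
Proof. exact: size_map. Qed.

Lemma count_leq_mono (s : seq nat) (x y : nat) : y \in s ->
  (count (fun z => z <= x) s < count (fun z => z <= y) s) = (x < y).
Proof.
move=> ys; case: (ltnP x y) => xy; last first.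
  apply/negbTE; rewrite -leqNgt; apply: sub_count => z /= zy.
  exact: leq_trans zy xy.
have -> : count (fun z => z <= y) s
        = count (fun z => z <= x) s + count (fun z => x < z <= y) s.
  rewrite -(count_predUI (fun z => z <= x)).
  rewrite [X in _ + X](_ : _ = 0) ?addn0.
    apply: eq_count => z /=; case: (leqP z x) => zx //=.
    exact: leq_trans zx (ltnW xy).
  apply/eqP; rewrite -leqn0 leqNgt -has_count; apply/hasPn => z _ /=.
  by case: leqP.
rewrite -addn1 leq_add2l -has_count; apply/hasP; exists y => //=.
by rewrite xy leqnn.
Qed.

Lemma st_order s i j : i < size s -> j < size s ->
  (nth 0 (st s) i < nth 0 (st s) j) = (nth 0 s i < nth 0 s j).
Proof.
move=> si sj; rewrite !(nth_map 0) //.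
by rewrite count_leq_mono // mem_nth.
Qed.

Lemma st_perm s : uniq s -> perm_eq (st s) (iota 1 (size s)).
Proof.
move=> us; have ust : uniq (st s).
  rewrite map_inj_in_uniq // => x y xs ys exy.
  by case: (ltngtP x y) => // h; move: h;
    rewrite -(@count_leq_mono s) // exy ltnn.
apply: uniq_perm => //; first exact: iota_uniq.
have sub : {subset st s <= iota 1 (size s)}.
  move=> _ /mapP[x xs ->]; rewrite mem_iota add1n ltnS count_size andbT.
  by rewrite -has_count; apply/hasP; exists x => /=.
have szle : size (iota 1 (size s)) <= size (st s) by rewrite size_iota size_st.
by case: (uniq_min_size ust sub szle).
Qed.

Lemma st_id s : perm_eq s (iota 1 (size s)) -> st s = s.
Proof.
move=> ps; rewrite -[RHS]map_id; apply/eq_in_map => x.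
rewrite (perm_mem ps) mem_iota add1n ltnS => /andP[x1 xn].
rewrite (seq.permP ps) -(subnKC xn) iotaD count_cat.
rewrite (_ : count _ (iota 1 x) = x); last first.
  rewrite -[RHS](size_iota 1); apply/eqP; rewrite -all_count.
  by apply/allP => z; rewrite mem_iota add1n ltnS => /andP[].
rewrite (_ : count _ _ = 0) ?addn0 //.
apply/eqP; rewrite -leqn0 leqNgt -has_count; apply/hasPn => z /=.
by rewrite mem_iota add1n => /andP[]; rewrite ltnNge.
Qed.

Lemma st_unique s t : size t = size s -> perm_eq t (iota 1 (size s)) ->
  (forall i j, i < size s -> j < size s ->
     (nth 0 t i < nth 0 t j) = (nth 0 s i < nth 0 s j)) ->
  t = st s.
Proof.
move=> sz pt ord; rewrite -(@st_id t) ?sz //.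
apply: (@eq_from_nth _ 0); rewrite !size_st // => i; rewrite sz => si.
rewrite !(nth_map 0) ?sz //.
have E (u : seq nat) (p : pred nat) : size u = size s ->
    count p u = count (fun l => p (nth 0 u l)) (iota 0 (size s)).
  by move=> <-; rewrite -[in LHS](mkseq_nth 0 u) count_map.
rewrite (E t) // (E s) //; apply: eq_in_count => l.
rewrite mem_iota add0n => /= sl.
by rewrite leqNgt ord // -leqNgt.
Qed.

(* Main.v *)
Require Import Defs.
From mathcomp Require Import all_boot all_fingroup.
From mathcomp Require Import zify.

(** Fix a set [M] of positions, and count the permutations that have an
    occurrence of [tau] at every position of [M]. Since [tau] has no
    self-overlaps, there are none unless the windows in [M] pairwise share at
    most an endpoint. In that case, rearranging the entries of every window by
    [tau^-1 tau'] is well defined, because this permutation fixes the two ends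
    of a window, and it turns the marked occurrences of [tau] into occurrences
    of [tau']. Hence the counts for [tau] and [tau'] agree for each [M], and by
    Moebius inversion over the supersets of [M] the set of all occurrences has
    the same distribution for both patterns. *)

Set Implicit Arguments.
Unset Strict Implicit.
Unset Printing Implicit Defensive.

Lemma size_word n (s : 'S_n) : size (word s) = n.
Proof. by rewrite size_map size_enum_ord. Qed.

Lemma nth_word n (s : 'S_n) (x : 'I_n) : nth 0 (word s) x = (s x).+1.
Proof. by rewrite (nth_map x) ?size_enum_ord // nth_ord_enum. Qed.

Lemma word_uniq n (s : 'S_n) : uniq (word s).
Proof.
by rewrite map_inj_uniq ?enum_uniq // => x y [] /val_inj /perm_inj.
Qed.

Lemma perm_word n (s : 'S_n) : perm_eq (word s) (iota 1 n).
Proof.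
have sub : {subset word s <= iota 1 n}.
  by move=> _ /mapP[x _ ->]; rewrite mem_iota add1n; apply: ltn_ord.
apply: uniq_perm; rewrite ?word_uniq ?iota_uniq //.
have le : size (iota 1 n) <= size (word s) by rewrite size_iota size_word.
by case: (uniq_min_size (word_uniq s) sub le).
Qed.

(** Needed to turn a standardized segment into an element of ['S_n], to which [no_self_overlap]
    applies. *)
Lemma word_surj n (w : seq nat) :
  perm_eq w (iota 1 n) -> exists s : 'S_n, word s = w.
Proof.
move=> pw; have sw : size w = n by rewrite (perm_size pw) size_iota.
have uw : uniq w by rewrite (perm_uniq pw) iota_uniq.
have w_in i : i < n -> 0 < nth 0 w i < n.+1.
  by move=> lt_in; rewrite -[n.+1]add1n -mem_iota -(perm_mem pw) mem_nth ?sw.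
have bound (i : 'I_n) : (nth 0 w i).-1 < n by have := w_in i (ltn_ord i); lia.
have f_inj : injective (fun i : 'I_n => Ordinal (bound i)).
  move=> i j [eq_ij]; apply/ord_inj/eqP.
  rewrite -(nth_uniq 0 _ _ uw) ?sw ?ltn_ord //; apply/eqP.
  by have := w_in i (ltn_ord i); have := w_in j (ltn_ord j); move=> /=; lia.
exists (perm f_inj); apply: (@eq_from_nth _ 0); rewrite size_word ?sw // => i lt_in.
rewrite (nth_word _ (Ordinal lt_in)) permE /=.
by have := w_in i lt_in; lia.
Qed.

(** Comparing entries instead of standardizing makes it easy to pass to a segment or to permute
    positions. The default [0] of [nth] is harmless where [i + m < size w]. *)
Definition occurs_at (m : nat) (tau : 'S_m.+1) (w : seq nat) (i : nat) : Prop :=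
  forall a b : 'I_m.+1, (tau a < tau b) = (nth 0 w (i + a) < nth 0 w (i + b)).

Lemma nth_segment w i j a : a < j.+1 - i -> nth 0 (segment w i j) a = nth 0 w (i + a).
Proof. by move=> lt_a; rewrite nth_take // nth_drop. Qed.

Lemma size_segment w i j : j < size w -> size (segment w i j) = j.+1 - i.
Proof. by move=> lt_j; rewrite size_take size_drop; case: ltnP; lia. Qed.

Lemma st_segmentP m (tau : 'S_m.+1) w i : i + m < size w ->
  st (segment w i (i + m)) = word tau <-> occurs_at tau w i.
Proof.
move=> lt_im; have sz : size (segment w i (i + m)) = m.+1.
  by rewrite size_segment //; lia.
have seg (a : 'I_m.+1) : nth 0 (segment w i (i + m)) a = nth 0 w (i + a).
  by rewrite nth_segment //; have := ltn_ord a; lia.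
split=> [eq_st a b | occ].
  by rewrite -!seg -st_order ?sz ?ltn_ord // eq_st !nth_word ltnS.
symmetry; apply: st_unique; rewrite ?size_word ?sz //; first exact: perm_word.
move=> a b lt_a lt_b.
have := occ (Ordinal lt_a) (Ordinal lt_b); rewrite -!seg /= => <-.
by rewrite (nth_word _ (Ordinal lt_a)) (nth_word _ (Ordinal lt_b)) ltnS.
Qed.

Lemma occurrencesP m (tau : 'S_m.+1) n (s : 'S_n) (p : 'I_n * 'I_n) :
  p \in occurrences tau s <-> p.2 = p.1 + m :> nat /\ occurs_at tau (word s) p.1.
Proof.
have lt_p2 : p.2 < size (word s) by rewrite size_word ltn_ord.
rewrite inE; split=> [/andP[le_p /eqP eq_st] | [eq_p occ]].
  have eq_p : p.2 = p.1 + m :> nat.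
    by have := congr1 size eq_st; rewrite size_st size_segment // size_word; lia.
  by split=> //; apply/st_segmentP; rewrite -eq_p.
rewrite eq_p leq_addr /=; apply/eqP/st_segmentP => //; by rewrite -eq_p.
Qed.

(** If [j < i + m], the segment from [i] to [j + m] has length at most [2 * m], and its
    standardization contains [tau] twice. *)
Lemma occurs_at_sep m (tau : 'S_m.+1) w i j : no_self_overlap tau -> uniq w ->
  j + m < size w -> occurs_at tau w i -> occurs_at tau w j ->
  i < j -> i + m <= j.
Proof.
move=> no_overlap uw lt_jm occ_i occ_j lt_ij; rewrite leqNgt; apply/negP => lt_j.
pose L := (j + m).+1 - i; pose u := segment w i (j + m).
have sz : size u = L by rewrite size_segment.
have /st_perm : uniq u by rewrite take_uniq ?drop_uniq.
rewrite sz => /word_surj[s word_s].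
have occ k : i + k + m <= j + m -> occurs_at tau w (i + k) ->
    occurs_at tau (word s) k.
  move=> le_k occ_k a b; rewrite occ_k.
  have := ltn_ord a; have := ltn_ord b => lt_b lt_a.
  by rewrite word_s st_order ?sz /L ?nth_segment ?addnA //; lia.
have lt0 : 0 < L by rewrite /L; lia.
have ltm : m < L by rewrite /L; lia.
have ltd : j - i < L by rewrite /L; lia.
have ltdm : j - i + m < L by rewrite /L; lia.
(* The two windows in coordinates relative to [i]; they differ because [i < j]. *)
pose p := (Ordinal lt0, Ordinal ltm); pose q := (Ordinal ltd, Ordinal ltdm).
have p_occ : p \in occurrences tau s.
  by apply/occurrencesP; split=> //=; apply: occ; rewrite ?addn0 //; lia.
have q_occ : q \in occurrences tau s.
  by apply/occurrencesP; split=> //=; apply: occ; rewrite ?subnKC //; lia.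
have le_L : L <= 2 * m by rewrite /L; lia.
have /card_le1_eqP/(_ p q p_occ q_occ) := no_overlap _ s le_L.
by move=> /(congr1 (fun r => val r.1)) /=; lia.
Qed.

(** Distinct windows share at most an endpoint, and [g] fixes both ends, so its actions on the
    windows glue together; gluing [g^-1] gives the inverse. *)
Lemma shuffle_windows m n (M : {set 'I_n * 'I_n}) (g : 'S_m.+1) :
  {in M, forall p : 'I_n * 'I_n, p.2 = p.1 + m :> nat} ->
  {in M &, forall p q : 'I_n * 'I_n, p.1 < q.1 -> p.1 + m <= q.1} ->
  g ord0 = ord0 -> g ord_max = ord_max ->
  exists pi : 'S_n, {in M, forall p : 'I_n * 'I_n, forall (a : 'I_m.+1) (x : 'I_n),
    x = p.1 + a :> nat -> pi x = p.1 + g a :> nat}.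
Proof.
move=> wf sep g0 gmax.
(* [h] acts inside some window around [x]. The default of [insubd] never occurs, since [h] keeps
   positions within the window. *)
pose F (h : 'S_m.+1) (x : 'I_n) : 'I_n :=
  if [pick p : 'I_n * 'I_n in M | p.1 <= x <= p.2] is Some p
  then insubd x (p.1 + h (inord (x - p.1))) else x.
have FE (h : 'S_m.+1) : h ord0 = ord0 -> h ord_max = ord_max ->
    {in M, forall p : 'I_n * 'I_n, forall (a : 'I_m.+1) (x : 'I_n),
      x = p.1 + a :> nat -> F h x = p.1 + h a :> nat}.
  move=> h0 hmax p Mp a x eq_x; have lt_a := ltn_ord a.
  rewrite /F; case: pickP => [q /andP[Mq x_q] | /(_ p)]; last first.
    by rewrite Mp /= wf //; lia.
  have val_q b : val (insubd x (q.1 + h b)) = q.1 + h b.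
    rewrite val_insubd ifT //; have := ltn_ord (h b); have := ltn_ord q.2.
    by rewrite wf //=; lia.
  rewrite val_q; move: x_q; rewrite wf //= => x_q.
  (* If the picked window [q] differs from [p], then [x] is the last position of one and the first
     of the other, and [h] fixes it in both. *)
  case: (ltngtP p.1 q.1) => [lt_pq | lt_qp | /= eq_pq].
  - have le_pq := sep p q Mp Mq lt_pq.
    have -> : a = ord_max by apply: val_inj => /=; lia.
    have -> : inord (x - q.1) = ord0 :> 'I_m.+1.
      by apply: val_inj; rewrite /= inordK; lia.
    by rewrite h0 hmax /=; lia.
  - have le_qp := sep q p Mq Mp lt_qp.
    have -> : a = ord0 by apply: val_inj => /=; lia.
    have -> : inord (x - q.1) = ord_max :> 'I_m.+1.
      by apply: val_inj; rewrite /= inordK; lia.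
    by rewrite h0 hmax /=; lia.
  - have -> : inord (x - q.1) = a by apply: val_inj; rewrite /= inordK; lia.
    by rewrite eq_pq.
have gV0 : (g^-1)%g ord0 = ord0 by rewrite -[in LHS]g0 permK.
have gVmax : (g^-1)%g ord_max = ord_max by rewrite -[in LHS]gmax permK.
have FK : cancel (F g) (F (g^-1)%g).
  move=> x; case pick_x: [pick p : 'I_n * 'I_n in M | p.1 <= x <= p.2] => [p|]; last first.
    by rewrite {2}/F pick_x /F pick_x.
  move: pick_x; case: pickP => // q /andP[Mq]; rewrite wf // => x_q _.
  have eq_x : x = q.1 + (inord (x - q.1) : 'I_m.+1) :> nat.
    by rewrite inordK /=; lia.
  apply: val_inj; rewrite /= (FE _ gV0 gVmax q Mq _ _ (FE _ g0 gmax q Mq _ _ eq_x)).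
  by rewrite permK -eq_x.
exists (perm (can_inj FK)) => p Mp a x eq_x.
by rewrite permE; apply: FE.
Qed.

(** Rearranging positions by a fixed [pi] is injective on permutations and turns the marked
    occurrences of [tau] into occurrences of [tau']. *)
Lemma card_marked_le m (tau tau' : 'S_m.+1) n (M : {set 'I_n * 'I_n}) :
  no_self_overlap tau -> tau ord0 = tau' ord0 -> tau ord_max = tau' ord_max ->
  #|[set s : 'S_n | M \subset occurrences tau s]|
    <= #|[set s : 'S_n | M \subset occurrences tau' s]|.
Proof.
move=> no_overlap eq0 eqmax.
(* A single witness [s0] already forces the shape of [M] required by [shuffle_windows]. *)
have [-> | [s0]] := set_0Vmem [set s : 'S_n | M \subset occurrences tau s].
  by rewrite cards0.
rewrite inE => /subsetP M_s0.
have wf : {in M, forall p : 'I_n * 'I_n, p.2 = p.1 + m :> nat}.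
  by move=> p /M_s0/occurrencesP[].
have sep : {in M &, forall p q : 'I_n * 'I_n, p.1 < q.1 -> p.1 + m <= q.1}.
  move=> p q /M_s0/occurrencesP[_ occ_p] /M_s0/occurrencesP[eq_q occ_q].
  apply: (occurs_at_sep no_overlap (word_uniq s0)) => //.
  by rewrite size_word -eq_q.
(* Products compose left to right: [tau'] acts first, then [tau^-1]. Likewise [pi * s] reads [s] at
   the position [pi x]. *)
have [||pi piE] := @shuffle_windows m n M (tau' * tau^-1)%g wf sep.
- by rewrite permM -eq0 permK.
- by rewrite permM -eqmax permK.
rewrite -(card_imset _ (mulgI pi)); apply/subset_leq_card/subsetP => _ /imsetP[s + ->].
rewrite !inE => /subsetP M_s; apply/subsetP => p Mp.
have /occurrencesP[eq_p occ] := M_s p Mp.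
apply/occurrencesP; split=> // a b.
have tau_g c : tau' c = tau ((tau' * tau^-1)%g c) by rewrite permM permKV.
have nth_pi (c : 'I_m.+1) : nth 0 (word (pi * s)%g) (p.1 + c)
    = nth 0 (word s) (p.1 + (tau' * tau^-1)%g c).
  have lt_c : p.1 + c < n.
    by have := ltn_ord c; have := ltn_ord p.2; rewrite eq_p /=; lia.
  rewrite (nth_word _ (Ordinal lt_c)) (permM pi s) -nth_word.
  by congr (nth 0 _ _); apply: piE.
by rewrite !nth_pi -occ -!tau_g.
Qed.

(** Moebius inversion as an induction on the size of the complement of [M]: the terms for strictly
    larger sets agree by induction and cancel. *)
Lemma card_superset_inj (S T : finType) (f g : S -> {set T}) :
  (forall M : {set T}, #|[set s | M \subset f s]| = #|[set s | M \subset g s]|) ->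
  forall M : {set T}, #|[set s | f s == M]| = #|[set s | g s == M]|.
Proof.
move=> eq_fg M; have [k] := ubnP #|~: M|; elim: k M => // k IHk M lt_k.
have split_card (h : S -> {set T}) : #|[set s | M \subset h s]| =
    #|[set s | h s == M]| + \sum_(N : {set T} | M \proper N) #|[set s | h s == N]|.
  have -> : #|[set s | M \subset h s]| =
      \sum_(N : {set T} | M \subset N) #|[set s | h s == N]|.
    rewrite -sum1_card (partition_big h (fun N => M \subset N)) => [|s]; last by rewrite inE.
    apply: eq_bigr => N sMN; rewrite -sum1_card; apply: eq_bigl => s.
    by rewrite !inE andb_idl // => /eqP->.
  rewrite (bigD1 M) //=; congr (_ + _); apply: eq_bigl => N.
  by rewrite properEneq andbC eq_sym.
have := eq_fg M; rewrite !split_card.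
rewrite (eq_bigr (fun N => #|[set s | g s == N]|)) => [/addIn //|N ltMN].
apply: IHk; rewrite (leq_trans _ (_ : #|~: M| <= k)) //.
by rewrite proper_card // properC.
Qed.

Theorem mainTheorem4 (m : nat) (tau tau' : 'S_m.+1) :
  1 <= m ->
  no_self_overlap tau -> no_self_overlap tau' ->
  tau ord0 = tau' ord0 -> tau ord_max = tau' ord_max ->
  forall n k : nat, nb_perm_occ tau n k = nb_perm_occ tau' n k.
Proof.
move=> _ no_overlap no_overlap' eq0 eqmax n k.
have eq_card : forall M : {set 'I_n * 'I_n},
    #|[set s : 'S_n | occurrences tau s == M]| =
    #|[set s : 'S_n | occurrences tau' s == M]|.
  apply: card_superset_inj => M.
  (* The hypotheses are symmetric in [tau] and [tau'], so the inequality holds both ways. *)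
  by apply/eqP; rewrite eqn_leq !card_marked_le.
have by_occ (t : 'S_m.+1) : nb_perm_occ t n k =
    \sum_(M : {set 'I_n * 'I_n} | #|M| == k) #|[set s : 'S_n | occurrences t s == M]|.
  rewrite /nb_perm_occ -sum1_card.
  rewrite (partition_big (@occurrences _ n t) (fun M => #|M| == k)) => [|s]; last by rewrite inE.
  apply: eq_bigr => M cardM; rewrite -sum1_card; apply: eq_bigl => s.
  by rewrite !inE andb_idl // => /eqP occ_s; rewrite /nb_occ occ_s.
by rewrite !by_occ; apply: eq_bigr.
Qed.
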